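(* Let $\mathcal{A}$ be a unital operator algebra, let $\mathcal{H}$ be a Hilbert space, and let $\Phi:\mathcal{A}\to\mathcal{B}(\mathcal{H})$ be a unital completely bounded homomorphism. Then \[ \|\Phi\|_{wcb} = \frac12\big(\|\Phi\|_{cb}+\|\Phi\|_{cb}^{-1}\big). \]
   Context: Hilbert spaces are complex and nonzero, and $\mathcal{B}(\mathcal{H})$ is the algebra of bounded operators on $\mathcal{H}$. A unital operator algebra $\mathcal{A}$ carries a family of norms on the matrix algebras $\mathcal{M}_n(\mathcal{A})$, $n\ge 1$, and may be represented unitally and completely isometrically as an algebra (not necessarily self-adjoint) of operators on some Hilbert space $\mathcal{K}$, so that the norm on $\mathcal{M}_n(\mathcal{A})$ is the operator norm on $\mathcal{B}(\mathcal{K}^{(n)})$, where $\mathcal{K}^{(n)}$ is the direct sum of $n$ copies of $\mathcal{K}$. For a bounded linear map $\Phi:\mathcal{A}\to\mathcal{B}(\mathcal{H})$, let $\Phi^{(n)}:\mathcal{M}_n(\mathcal{A})\to\mathcal{M}_n(\mathcal{B}(\mathcal{H}))\simeq\mathcal{B}(\mathcal{H}^{(n)})$ be the map obtained by applying $\Phi$ entrywise. The completely bounded norm is $\|\Phi\|_{cb}=\sup_{n\ge1}\|\Phi^{(n)}\|$; $\Phi$ is completely bounded if this is finite. The numerical radius of an operator $X$ is $w(X)=\sup\{|\langle Xx,x\rangle| : \|x\|=1\}$. The complete numerical radius norm of $\Phi$ is \[ \|\Phi\|_{wcb}=\sup_{n\ge1}\ \sup_{A\in\mathcal{M}_n(\mathcal{A}),\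 \|A\|\le1} w(\Phi^{(n)}(A)). \] *)

(* Defs.v *)
From HB Require Import structures.
From mathcomp Require Import all_boot all_order all_algebra.
From mathcomp Require Import complex ring lra.
From mathcomp Require Import all_classical all_reals all_analysis.

Set Implicit Arguments.
Unset Strict Implicit.
Unset Printing Implicit Defensive.

Import Order.TTheory GRing.Theory Num.Theory.
Import numFieldNormedType.Exports.

Local Open Scope classical_set_scope.
Local Open Scope ring_scope.

(* The forms {dot H for Num.conj} are linear in the first variable and
   conjugate-linear in the second one. *)
HB.mixin Record isHilbert (R : realType) H & CompleteNormedModule R[i] H := {
  inner : {dot H for (@Num.conj R[i])};
  inner_norm : forall x : H, `|x| ^+ 2 = inner x x;
  hilbert_nontrivial : exists x : H, x != 0
}.

#[short(type="hilbertType")]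
HB.structure Definition Hilbert (R : realType) :=
  {H of CompleteNormedModule R[i] H & isHilbert R H}.

(* The norm of a normed module over R[i] takes its values in R[i]; rnorm is the
   same norm seen as a real number. *)
Definition rnorm (R : realType) (V : normedZmodType R[i]) (x : V) : R :=
  complex.Re `|x|.

Section RealNorm.
Variables (R : realType) (V : normedZmodType R[i]).
Implicit Types x y : V.

Lemma rnormE x : (rnorm x)%:C%C = `|x|.
Proof. by rewrite /rnorm RRe_real// normr_real. Qed.

Lemma rnorm_ge0 x : 0 <= rnorm x.
Proof. by rewrite -lecR rnormE normr_ge0. Qed.

Lemma rnorm0 : rnorm (0 : V) = 0.
Proof. by rewrite /rnorm normr0. Qed.

Lemma rnormD x y : rnorm (x + y) <= rnorm x + rnorm y.
Proof. by rewrite -lecR rmorphD/= !rnormE ler_normD. Qed.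

Lemma rnorm_sum (I : finType) (F : I -> V) :
  rnorm (\sum_i F i) <= \sum_i rnorm (F i).
Proof.
by rewrite -lecR rmorph_sum/= rnormE (eq_bigr _ (fun i _ => rnormE (F i)))
  ler_norm_sum.
Qed.

End RealNorm.

Lemma rnormZ (R : realType) (V : normedModType R[i]) (a : R[i]) (x : V) :
  rnorm (a *: x) = rnorm a * rnorm x.
Proof. by apply: complexI; rewrite rmorphM/= !rnormE normrZ. Qed.

Section BoundedOperators.
Variables (R : realType) (H : hilbertType R).

Definition bounded_linear : {pred (H -> H)} := fun f =>
  `[< linear f /\ exists M : R, forall x, rnorm (f x) <= M * rnorm x >].

Record bop := Bop { bop_val :> H -> H; bop_valP : bop_val \in bounded_linear }.

HB.instance Definition _ := [isSub for bop_val].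
HB.instance Definition _ := [Choice of bop by <:].

Lemma bounded_linear_submod : submod_closed bounded_linear.
Proof.
split=> [|a f g /asboolP[lf [M fM]] /asboolP[lg [N gN]]]; apply/asboolP.
  split=> [k x y|]; first by rewrite -[LHS]/0 -[RHS]/(k *: 0 + 0) scaler0 addr0.
  by exists 0 => x; rewrite mul0r rnorm0.
split=> [k x y|].
  by rewrite !fctE lf lg !scalerDr !scalerA [a * k]mulrC addrACA.
exists (rnorm a * M + N) => x; rewrite !fctE.
by rewrite (le_trans (rnormD _ _))// rnormZ mulrDl lerD// -mulrA ler_wpM2l
  ?rnorm_ge0.
Qed.

HB.instance Definition _ :=
  GRing.isSubmodClosed.Build _ _ bounded_linear bounded_linear_submod.
HB.instance Definition _ := [SubChoice_isSubLmodule of bop by <:].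

Implicit Types S T : bop.

Lemma bop_linear T : linear T.
Proof. by have /asboolP[] := bop_valP T. Qed.

HB.instance Definition _ T :=
  GRing.isLinear.Build R[i] H H *:%R (bop_val T) (@bop_linear T).

Lemma bop_bounded T :
  exists2 M : R, 0 <= M & forall x, rnorm (T x) <= M * rnorm x.
Proof.
have /asboolP[_ [M TM]] := bop_valP T; exists `|M| => // x.
by rewrite (le_trans (TM x))// ler_wpM2r ?rnorm_ge0// ler_norm.
Qed.

Lemma bopP S T : S =1 T -> S = T.
Proof. by move=> ST; apply/val_inj/funext. Qed.

Fact bop_one_subproof : (id : H -> H) \in bounded_linear.
Proof. by apply/asboolP; split=> //; exists 1 => x; rewrite mul1r. Qed.

Definition bop_one := Bop bop_one_subproof.

Fact bop_mul_subproof S T : S \o T \in bounded_linear.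
Proof.
apply/asboolP; split=> [k x y|]; first by rewrite /= !linearP.
have [[M M0 SM] [N _ TN]] := (bop_bounded S, bop_bounded T).
by exists (M * N) => x; rewrite (le_trans (SM _))//= -mulrA ler_wpM2l.
Qed.

Definition bop_mul S T := Bop (bop_mul_subproof S T).

Fact bop_mulA : associative bop_mul.
Proof. by move=> S T U; apply: bopP. Qed.
Fact bop_mul1 : left_id bop_one bop_mul.
Proof. by move=> T; apply: bopP. Qed.
Fact bop_1mul : right_id bop_one bop_mul.
Proof. by move=> T; apply: bopP. Qed.
Fact bop_mulDl : left_distributive bop_mul +%R.
Proof. by move=> S T U; apply: bopP. Qed.
Fact bop_mulDr : right_distributive bop_mul +%R.
Proof. by move=> S T U; apply: bopP => x /=; rewrite linearD. Qed.
Fact bop_one_neq0 : bop_one != 0.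
Proof.
have [x x0] := @hilbert_nontrivial R H.
by apply: contraNneq x0 => /(congr1 (fun T : bop => T x)) /= ->.
Qed.

HB.instance Definition _ := GRing.Zmodule_isNzRing.Build bop
  bop_mulA bop_mul1 bop_1mul bop_mulDl bop_mulDr bop_one_neq0.

Fact bop_scalerAl (k : R[i]) S T : k *: (S * T) = k *: S * T.
Proof. by apply: bopP. Qed.
HB.instance Definition _ := GRing.Lmodule_isLalgebra.Build R[i] bop bop_scalerAl.

Fact bop_scalerAr (k : R[i]) S T : k *: (S * T) = S * (k *: T).
Proof. by apply: bopP => x /=; rewrite linearZ. Qed.
HB.instance Definition _ := GRing.Lalgebra_isAlgebra.Build R[i] bop bop_scalerAr.

(* Both sets are nonempty and bounded: see opnorm_has_sup, numradius_has_sup. *)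
Definition opnorm T : R := sup [set rnorm (T x) | x in [set x | rnorm x <= 1]].

Definition numradius T : R :=
  sup [set rnorm (inner (T x) x) | x in [set x | rnorm x = 1]].

End BoundedOperators.

Section CauchySchwarz.
Variables (C : numClosedFieldType) (V : lmodType C).
Variable form : {dot V for (@Num.conj C)}.
Local Notation "''[' u , v ]" := (form u v) : ring_scope.

Lemma dot_ge0 u : 0 <= '[u, u].
Proof.
have [->|u0] := eqVneq u 0; first by rewrite linear0r.
by rewrite ltW// neq0_dnorm_gt0.
Qed.

Lemma dot_CauchySchwarz u v : `|'[u, v]| ^+ 2 <= '[u, u] * '[v, v].
Proof.
have [->|v0] := eqVneq v 0; first by rewrite !(linear0r form) normr0 expr0n mulr0.
have vv_gt0 : 0 < '[v, v] by rewrite neq0_dnorm_gt0.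
have hC x y : '[x, y] = Num.conj '[y, x] by rewrite hermC expr0 mul1r.
pose a := '[u, v] / '[v, v].
have := dot_ge0 (u - a *: v).
have -> : '[u - a *: v, u - a *: v] = '[u, u] - `|'[u, v]| ^+ 2 / '[v, v].
  have aN : Num.conj a = '[v, u] / '[v, v].
    by rewrite rmorphM/= -hC fmorphV/= -hC.
  have Zl x y : '[a *: x, y] = a * '[x, y] by rewrite linearZl_LR.
  have Zr x y : '[x, a *: y] = Num.conj a * '[x, y] by rewrite linearZr_LR.
  rewrite linearBl/= !linearBr/= !Zl !Zr aN normCK -[Num.conj '[u, v]]hC /a.
  have d_neq0 : '[v, v] != 0 by rewrite gt_eqF.
  by field.
by rewrite subr_ge0 ler_pdivrMr.
Qed.

Lemma dot_triangle u v :
  sqrtC '[u + v, u + v] <= sqrtC '[u, u] + sqrtC '[v, v].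
Proof.
have s0 w : 0 <= sqrtC '[w, w] by rewrite sqrtC_ge0 dot_ge0.
rewrite -(@ler_pXn2r _ 2)// ?nnegrE ?addr_ge0// sqrrD !sqrtCK.
rewrite linearDl/= !linearDr/=.
have -> : '[u, u] + '[u, v] + ('[v, u] + '[v, v]) =
    '[u, u] + ('[u, v] + '[v, u]) + '[v, v] by ring.
rewrite lerD2r lerD2l [X in _ + X]hermC expr0 mul1r.
have cs : `|'[u, v]| <= sqrtC '[u, u] * sqrtC '[v, v].
  rewrite -(@ler_pXn2r _ 2)// ?nnegrE ?mulr_ge0// exprMn !sqrtCK.
  exact: dot_CauchySchwarz.
rewrite (le_trans (real_ler_norm _))//.
  by apply/CrealP; rewrite rmorphD/= conjCK addrC.
by rewrite (le_trans (ler_normD _ _))// norm_conjC -mulr2n lerMn2r cs orbT.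
Qed.

End CauchySchwarz.

Section Suprema.
Variables (R : realType) (H : hilbertType R).
Implicit Types T : bop H.

Lemma opnorm_has_sup T :
  has_sup [set rnorm (T x) | x in [set x | rnorm x <= 1]].
Proof.
split; first by exists (rnorm (T 0)), 0 => //=; rewrite rnorm0.
have [M M0 TM] := bop_bounded T; exists M => _ [x /= x1 <-].
by rewrite (le_trans (TM x))// ler_piMr.
Qed.

Lemma rnorm_inner (x y : H) : rnorm (inner x y) <= rnorm x * rnorm y.
Proof.
rewrite -lecR rmorphM/= !rnormE -(@ler_pXn2r _ 2)// ?nnegrE ?mulr_ge0//.
by rewrite exprMn !inner_norm dot_CauchySchwarz.
Qed.

Lemma numradius_has_sup T :
  has_sup [set rnorm (inner (T x) x) | x in [set x | rnorm x = 1]].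
Proof.
split.
  have [h h0] := @hilbert_nontrivial R H; pose x := `|h|^-1 *: h.
  exists (rnorm (inner (T x) x)), x => //=; apply: complexI.
  by rewrite rnormE normrZ normfV normr_id mulVf ?normr_eq0.
have [M M0 TM] := bop_bounded T; exists M => _ [x /= x1 <-].
by rewrite (le_trans (rnorm_inner _ _))// x1 mulr1 (le_trans (TM x))// x1 mulr1.
Qed.

End Suprema.

(* The Hilbert space direct sum of n + 1 copies of H. *)
Definition dirsum (R : realType) (H : hilbertType R) (n : nat) :=
  {ffun 'I_n.+1 -> H}.

Section DirectSum.
Variables (R : realType) (H : hilbertType R) (n : nat).
Local Notation dirsum := (dirsum H n).

HB.instance Definition _ := GRing.Lmodule.on dirsum.

Implicit Types x y : dirsum.

Definition dirsum_inner x y : R[i] := \sum_i inner (x i) (y i).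

Fact dirsum_inner_bilinear :
  bilinear_for ( *%R : R[i] -> R[i] -> R[i])
    (@Num.conj R[i] \; *%R : R[i] -> R[i] -> R[i]) dirsum_inner.
Proof.
split=> [y|x] a u v; rewrite /dirsum_inner /= mulr_sumr -big_split/=;
  apply: eq_bigr => i _; rewrite !ffunE.
  by rewrite linearDl/= linearZl_LR.
by rewrite linearDr/= linearZr_LR.
Qed.

HB.instance Definition _ := bilinear_isBilinear.Build R[i] dirsum dirsum R[i]
  *%R (@Num.conj R[i] \; *%R) dirsum_inner dirsum_inner_bilinear.

Fact dirsum_inner_hermitian x y :
  dirsum_inner x y = (-1) ^+ false * Num.conj (dirsum_inner y x).
Proof.
rewrite expr0 mul1r /dirsum_inner rmorph_sum; apply: eq_bigr => i _.
by rewrite [LHS]hermC expr0 mul1r.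
Qed.

HB.instance Definition _ := isHermitianSesquilinear.Build R[i] dirsum false
  (@Num.conj R[i]) dirsum_inner dirsum_inner_hermitian.

Fact dirsum_inner_gt0 x : x != 0 -> 0 < dirsum_inner x x.
Proof.
move=> x0; have [i xi0] : exists i, x i != 0.
  apply/existsP; apply: contraNT x0; rewrite negb_exists => /forallP x0.
  by apply/eqP/ffunP => i; rewrite ffunE; apply/eqP; have := x0 i; rewrite negbK.
rewrite /dirsum_inner (bigD1 i)//= ltr_pwDl ?neq0_dnorm_gt0//.
by rewrite sumr_ge0// => j _; exact: dot_ge0.
Qed.

HB.instance Definition _ :=
  isDotProduct.Build R[i] dirsum dirsum_inner dirsum_inner_gt0.

Definition dirsum_norm x : R[i] := sqrtC (\sum_i `|x i| ^+ 2).

Fact dirsum_normE x : dirsum_norm x ^+ 2 = dirsum_inner x x.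
Proof. by rewrite sqrtCK; apply: eq_bigr => i _; exact: inner_norm. Qed.

Fact dirsum_normE' x : dirsum_norm x = sqrtC (dirsum_inner x x).
Proof. by congr sqrtC; apply: eq_bigr => i _; exact: inner_norm. Qed.

Fact dirsum_ler_normD x y : dirsum_norm (x + y) <= dirsum_norm x + dirsum_norm y.
Proof. by rewrite !dirsum_normE' dot_triangle. Qed.

Fact dirsum_normrZ (a : R[i]) x : dirsum_norm (a *: x) = `|a| * dirsum_norm x.
Proof.
rewrite /dirsum_norm -[`|a|](@sqrCK _ `|a|)// -sqrtCM ?nnegrE ?exprn_ge0//; last first.
  by rewrite sumr_ge0// => i _; rewrite exprn_ge0.
congr sqrtC; rewrite mulr_sumr; apply: eq_bigr => i _.
by rewrite ffunE normrZ exprMn.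
Qed.

Fact dirsum_norm0_eq0 x : dirsum_norm x = 0 -> x = 0.
Proof.
move=> nx; apply/eqP/negPn/negP => /dirsum_inner_gt0.
by rewrite -dirsum_normE nx expr0n ltxx.
Qed.

HB.instance Definition _ := Lmodule_isNormed.Build R[i] dirsum
  dirsum_ler_normD dirsum_normrZ dirsum_norm0_eq0.

Lemma dirsum_norm_ge x i : `|x i| <= `|x|.
Proof.
rewrite -[`|x|]/(sqrtC _) -(@ler_pXn2r _ 2)// ?nnegrE ?sqrtC_ge0//; last first.
  by rewrite sumr_ge0// => j _; rewrite exprn_ge0.
by rewrite sqrtCK (bigD1 i)//= lerDl sumr_ge0//.
Qed.

Lemma dirsum_norm_le x : `|x| <= \sum_i `|x i|.
Proof.
have s0 : 0 <= \sum_i `|x i| by rewrite sumr_ge0.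
rewrite -[`|x|]/(sqrtC _) -(@ler_pXn2r _ 2)// ?nnegrE ?sqrtC_ge0//; last first.
  by rewrite sumr_ge0// => j _; rewrite exprn_ge0.
rewrite sqrtCK [leRHS]expr2 mulr_suml ler_sum// => i _.
by rewrite expr2 ler_wpM2l// (bigD1 i)//= lerDl sumr_ge0.
Qed.

Fact dirsum_complete (F : set_system dirsum) :
  ProperFilter F -> cauchy F -> cvg F.
Proof.
move=> FF /cauchy_ballP Fc.
have Fi i : cvg ((fun x : dirsum => x i) @ F).
  apply: cauchy_cvg; apply/cauchy_ballP => e e0.
  have := Fc _ e0; rewrite !near_simpl.
  move=> [[A B]/= [FA FB] AB].
  exists ((fun x : dirsum => x i) @` A, (fun x : dirsum => x i) @` B) => /=.
    split; [apply: filterS FA|apply: filterS FB] => x; exact: imageP.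
  move=> [_ _] /= [[x Ax <-] [y By <-]].
  have := AB (x, y) (conj Ax By); rewrite /= -!ball_normE /=.
  by apply: le_lt_trans; have := dirsum_norm_ge (x - y) i; rewrite !ffunE.
apply/cvg_ex; exists [ffun i => lim ((fun x : dirsum => x i) @ F)].
apply/cvgrPdist_lt => e e0.
have e1 : 0 < e / (n.+1%:R : R[i]) by rewrite divr_gt0.
have : \forall x \near F, forall i,
    `|lim ((fun x : dirsum => x i) @ F) - (x : dirsum) i| < e / n.+1%:R.
  apply: filter_forall => i.
  by have /cvgrPdist_lt/(_ _ e1) := Fi i.
apply: filterS => x xe; rewrite (le_lt_trans (dirsum_norm_le _))//.
have -> : e = \sum_(i < n.+1) e / n.+1%:R.
  by rewrite sumr_const card_ord -[RHS]mulr_natr divfK.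
by apply: ltr_sum => [|i _]; [apply/hasP; exists ord0; rewrite ?mem_index_enum|rewrite !ffunE].
Qed.

HB.instance Definition _ := Uniform_isComplete.Build dirsum dirsum_complete.

Fact dirsum_nontrivial : exists x, x != 0.
Proof.
have [h h0] := @hilbert_nontrivial R H; exists [ffun=> h].
by apply: contraNneq h0 => /ffunP/(_ ord0); rewrite !ffunE => ->.
Qed.

HB.instance Definition _ := isHilbert.Build R dirsum
  (inner := dirsum_inner) dirsum_normE dirsum_nontrivial.

End DirectSum.

Section OperatorMatrix.
Variables (R : realType) (H : hilbertType R) (n : nat).
Implicit Types T : 'M[bop H]_n.+1.

Definition opmx_fun T (x : dirsum H n) : dirsum H n :=
  [ffun i => \sum_j T i j (x j)].

Fact opmx_subproof T : opmx_fun T \in @bounded_linear R (dirsum H n).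
Proof.
apply/asboolP; split=> [a x y|].
  apply/ffunP => i; rewrite !ffunE scaler_sumr -big_split/=.
  by apply: eq_bigr => j _; rewrite !ffunE linearP.
pose M i j := sval (cid2 (bop_bounded (T i j))).
have M0 i j : 0 <= M i j by rewrite /M; case: cid2.
have TM i j h : rnorm (T i j h) <= M i j * rnorm h by rewrite /M; case: cid2.
have le_i (x : dirsum H n) i : rnorm (x i) <= rnorm x.
  by rewrite -lecR !rnormE dirsum_norm_ge.
exists (\sum_i \sum_j M i j) => x.
apply: (@le_trans _ _ (\sum_i rnorm (opmx_fun T x i))).
  rewrite -lecR rmorph_sum/= rnormE.
  by rewrite (eq_bigr _ (fun i _ => rnormE _)) dirsum_norm_le.
rewrite mulr_suml ler_sum// => i _; rewrite ffunE mulr_suml.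
rewrite (le_trans (rnorm_sum _))// ler_sum// => j _.
by rewrite (le_trans (TM _ _ _))// ler_wpM2l// le_i.
Qed.

(* The identification of M_(n+1)(B(H)) with B(H^(n+1)). *)
Definition opmx T : bop (dirsum H n) := Bop (opmx_subproof T).

End OperatorMatrix.

(* The index n of mxnorm stands for matrices of size n + 1.  Apart from
   definiteness, the properties of a norm follow from mxnorm_representation, in
   which iota preserves the unit (lrmorphism) and is completely isometric. *)
HB.mixin Record isOperatorAlgebra (R : realType) A & GRing.Algebra R[i] A := {
  mxnorm : forall n, 'M[A]_n.+1 -> R;
  mxnorm0_eq0 : forall n (a : 'M[A]_n.+1), mxnorm n a = 0 -> a = 0;
  mxnorm_representation : exists (K : hilbertType R)
    (iota : {lrmorphism A -> bop K}),
    forall n (a : 'M[A]_n.+1), mxnorm n a = opnorm (opmx (map_mx iota a))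
}.

#[short(type="operatorAlgType")]
HB.structure Definition OperatorAlgebra (R : realType) :=
  {A of GRing.Algebra R[i] A & isOperatorAlgebra R A}.

Section CompleteNorms.
Variables (R : realType) (A : operatorAlgType R) (H : hilbertType R).
Variable Phi : {linear A -> bop H}.

Definition ampliation n (a : 'M[A]_n.+1) : bop (dirsum H n) :=
  opmx (map_mx Phi a).

(* In the next two definitions the outer supremum is over the sizes n + 1. *)
Definition cbnorm : \bar R :=
  ereal_sup [set ereal_sup
    [set (opnorm (ampliation a))%:E | a in [set a : 'M[A]_n.+1 | mxnorm n a <= 1]]
  | n in [set: nat]].

Definition wcbnorm : \bar R :=
  ereal_sup [set ereal_sup
    [set (numradius (ampliation a))%:E | a in [set a : 'M[A]_n.+1 | mxnorm n a <= 1]]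
  | n in [set: nat]].

Definition completely_bounded : Prop := (cbnorm < +oo)%E.

End CompleteNorms.

(* Main.v *)
From HB Require Import structures.
Require Import Defs.
From mathcomp Require Import all_boot all_order all_algebra.
From mathcomp Require Import complex ring lra.
From mathcomp Require Import all_classical all_reals all_analysis.
Import Order.TTheory GRing.Theory Num.Theory.
Import numFieldNormedType.Exports.
Local Open Scope ring_scope.

Set Implicit Arguments.
Unset Strict Implicit.
Unset Printing Implicit Defensive.

(** Write [c] for the completely bounded norm of the unital homomorphism [Phi];
    [c >= 1] because [Phi 1 = 1].  Both inequalities come from Moebius
    maps of the unit disc with parameter [1 / c].

    Upper bound.  Let [a] be a contraction of M_n(A) and [T] its image.  Put
    [q = 1 / c] and suppose [q < 1].  In the completion of M_n(A) the element
    [(q - a) (1 - q a)^-1] is a limit of polynomials in [a] and has norm at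
    most 1 (von Neumann inequality for a Moebius map), so that
    [(q - T) (1 - q T)^-1] has norm at most [c].  Hence
    [||q x - T x|| <= c ||x - q T x||] for all [x]; since [c q = 1], squaring
    this inequality makes the two terms in [||T x||^2] cancel, and what is left
    for a unit vector is [2 (c - q) Re <T x, x> <= c^2 - q^2], which is
    [Re <T x, x> <= (c + 1/c) / 2] (lemma [rdot_spectral_le]).  As A need not be
    complete, the inverse is replaced by partial sums of the geometric series.

    Lower bound.  For a contraction [a] of M_n(A) the nilpotent matrix [Z] with
    single nonzero block [a] has [Z^2 = 0], so the Moebius map
    [z |-> (z + t) / (1 + t z)] sends it to [t + (1 - t^2) Z], a contraction of
    M_2n(A), for [0 <= t <= 1].  The numerical radius of the image of the latter is at least
    [t + (1 - t^2) ||Phi(a)|| / 2]; letting [||Phi(a)||] approach [c] and taking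
    [t = 1 / c] gives [(c + 1/c) / 2]
    (lemmas [opnorm_moebius_block], [opnorm_le_numradius_moebius_block]). *)

(** * Operator norm and numerical radius *)

Section HilbertGeometry.
Variables (R : realType) (H : hilbertType R).
Implicit Types (x y : H) (T : bop H) (k M : R).

Definition rdot x y : R := complex.Re (inner x y).

Lemma rnorm_sqr x : rnorm x ^+ 2 = rdot x x.
Proof.
by rewrite /rdot -inner_norm -rnormE -(rmorphXn (real_complex R)).
Qed.

Lemma Re_conj (a : R[i]) : complex.Re (Num.conj a) = complex.Re a.
Proof. by case: a. Qed.

Lemma rdotC x y : rdot x y = rdot y x.
Proof.
by rewrite /rdot [inner x y]hermC expr0 mul1r Re_conj.
Qed.

Lemma rdotZl k x y : rdot (k%:C%C *: x) y = k * rdot x y.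
Proof.
rewrite /rdot linearZl_LR /=; case: (inner x y) => a b /=.
by rewrite mul0r subr0.
Qed.

Lemma rdotDl x y z : rdot (x + y) z = rdot x z + rdot y z.
Proof. by rewrite /rdot linearDl raddfD. Qed.

Lemma rnormZr k x : rnorm (k%:C%C *: x) = `|k| * rnorm x.
Proof. by rewrite rnormZ /rnorm normc_def /= expr0n addr0 sqrtr_sqr. Qed.

Lemma rnormB_sqr (a b : R) x y :
  rnorm (a%:C%C *: x - b%:C%C *: y) ^+ 2 =
  a ^+ 2 * rnorm x ^+ 2 - 2 * a * b * rdot x y + b ^+ 2 * rnorm y ^+ 2.
Proof.
rewrite -scaleNr -rmorphN !rnorm_sqr !rdotDl !rdotZl.
rewrite ![rdot _ (_ + _)]rdotC !rdotDl !rdotZl [rdot y x]rdotC.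
by ring.
Qed.

Lemma rnormN x : rnorm (- x) = rnorm x.
Proof. by rewrite /rnorm normrN. Qed.

Lemma rnormB x y : rnorm (x - y) <= rnorm x + rnorm y.
Proof. by rewrite -[rnorm y]rnormN rnormD. Qed.

Lemma rnorm_eq0 x : rnorm x = 0 -> x = 0.
Proof. by move=> x0; apply/eqP; rewrite -normr_eq0 -rnormE x0. Qed.

Lemma rnorm_normalize x :
  x != 0 -> exists2 u : H, rnorm u = 1 & x = (rnorm x)%:C%C *: u.
Proof.
move=> x0; have nx : rnorm x != 0 by apply: contraNneq x0 => /rnorm_eq0 ->.
exists ((rnorm x)^-1%:C%C *: x).
  by rewrite rnormZr ger0_norm ?invr_ge0 ?rnorm_ge0// mulVf.
by rewrite scalerA -rmorphM/= divff// scale1r.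
Qed.

Lemma rnorm_le_opnorm T x : rnorm (T x) <= opnorm T * rnorm x.
Proof.
have [->|x0] := eqVneq x 0; first by rewrite linear0 !rnorm0 mulr0.
have [u u1 ->] := rnorm_normalize x0.
rewrite linearZ/= !rnormZr u1 mulr1 mulrC ler_wpM2r//.
by apply: ub_le_sup; [exact: (opnorm_has_sup T).2|exists u => //=; rewrite u1].
Qed.

Lemma opnorm_le T M :
  0 <= M -> (forall x, rnorm (T x) <= M * rnorm x) -> opnorm T <= M.
Proof.
move=> M0 TM; apply: ge_sup; first exact: (opnorm_has_sup T).1.
by move=> _ [x /= x1 <-]; rewrite (le_trans (TM x))// ler_piMr.
Qed.

Lemma opnorm_ge0 T : 0 <= opnorm T.
Proof.
have [x x0] := @hilbert_nontrivial R H; have [u u1 _] := rnorm_normalize x0.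
by have := rnorm_le_opnorm T u; rewrite u1 mulr1; apply: le_trans; exact: rnorm_ge0.
Qed.

Lemma opnorm1 : opnorm (1 : bop H) = 1.
Proof.
apply/le_anti/andP; split; first by apply: opnorm_le => // x; rewrite mul1r.
have [x x0] := @hilbert_nontrivial R H; have [u u1 _] := rnorm_normalize x0.
by have := rnorm_le_opnorm 1 u; rewrite u1 mulr1.
Qed.

Lemma opnormZ_le (a : R[i]) T : opnorm (a *: T) <= rnorm a * opnorm T.
Proof.
apply: opnorm_le => [|x]; first by rewrite mulr_ge0 ?rnorm_ge0 ?opnorm_ge0.
by rewrite rnormZ -mulrA ler_wpM2l ?rnorm_ge0 ?rnorm_le_opnorm.
Qed.

Lemma rdot_le_numradius T x : rdot (T x) x <= numradius T * rnorm x ^+ 2.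
Proof.
have [->|x0] := eqVneq x 0.
  by rewrite linear0 -rnorm_sqr rnorm0 expr0n mulr0.
have [u u1 ->] := rnorm_normalize x0.
rewrite linearZ/= rdotC !rdotZl rdotC rdotZl mulrA -expr2.
rewrite rnormZr u1 mulr1 ger0_norm ?rnorm_ge0// mulrC ler_wpM2r ?sqr_ge0//.
apply: (@le_trans _ _ (rnorm (inner (T u) u))).
  by rewrite -lecR rnormE; apply: le_trans (normc_ge_Re _); rewrite lecR ler_norm.
by apply: ub_le_sup; [exact: (numradius_has_sup T).2|exists u].
Qed.

Lemma numradius_le T M :
  (forall x, rnorm x = 1 -> rnorm (inner (T x) x) <= M) -> numradius T <= M.
Proof.
move=> TM; apply: ge_sup; first exact: (numradius_has_sup T).1.
by move=> _ [x /= x1 <-]; exact: TM.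
Qed.

(** Rotating [T] by a phase turns a modulus of its numerical range into a real
    part, so real parts suffice to control the numerical radius. *)
Lemma numradius_le_rdot T M :
  (forall (u : R[i]) x, rnorm u = 1 -> rnorm x = 1 ->
    rdot ((u *: T) x) x <= M) -> numradius T <= M.
Proof.
move=> TM; apply: numradius_le => x x1.
have [i0|i0] := eqVneq (inner (T x) x) 0.
  have n1 : rnorm (1 : R[i]) = 1 by rewrite /rnorm normr1.
  by have := TM 1 x n1 x1; rewrite scale1r /rdot i0 rnorm0.
pose u := `|inner (T x) x| / inner (T x) x.
have u1 : rnorm u = 1.
  by apply: complexI; rewrite rnormE normf_div normr_id divff ?normr_eq0.
apply: le_trans (TM u x u1 x1).
by rewrite /rdot linearZl_LR /= divfK.
Qed.

End HilbertGeometry.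

(** * Moebius transforms of a contraction *)

Lemma le_of_le_addX (R : realType) (a b k q : R) : 0 <= q < 1 ->
  (forall N, a <= b + q ^+ N * k) -> a <= b.
Proof.
move=> /andP[q0 q1] ab.
have cvgb : ((b + q ^+ N * k) @[N --> \oo] --> b)%classic.
  rewrite -[X in (_ --> X)%classic]addr0 -[X in b + X](mul0r k).
  apply: cvgD; first exact: cvg_cst.
  by apply: cvgMl; apply: cvg_expr; rewrite ger0_norm.
rewrite -(cvg_lim _ cvgb)//; apply: limr_ge; first by apply/cvg_ex; exists b.
exact: nearW.
Qed.

Section Moebius.
Variables (R : realType) (q : R).
Hypothesis q01 : 0 <= q < 1.

(* The Moebius map is num / den, and [geo N] is a partial sum of the series of
   1 / den. *)
Let num : {poly R[i]} := q%:C%C%:P - 'X.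
Let den : {poly R[i]} := 1 - q%:C%C *: 'X.
Let geo N : {poly R[i]} := \sum_(i < N) (q%:C%C *: 'X) ^+ i.

Let horner_num (H : hilbertType R) (T : bop H) x :
  horner_alg T num x = q%:C%C *: x - T x.
Proof. by rewrite raddfB/= horner_algC horner_algX. Qed.

Let horner_den (H : hilbertType R) (T : bop H) x :
  horner_alg T den x = x - q%:C%C *: T x.
Proof. by rewrite raddfB/= rmorph1 linearZ/= horner_algX. Qed.

Let den_geo N : den * geo N = 1 - (q ^+ N)%:C%C *: 'X^N.
Proof.
by rewrite /den -[in LHS]opprB mulNr -subrX1 opprB exprZn rmorphXn.
Qed.

Let hornerM (H : hilbertType R) (T : bop H) (p r : {poly R[i]}) x :
  horner_alg T (p * r) x = horner_alg T p (horner_alg T r x).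
Proof. by rewrite rmorphM. Qed.

Let hornerXn (H : hilbertType R) (T : bop H) N : horner_alg T 'X^N = T ^+ N.
Proof. by rewrite rmorphXn/= horner_algX. Qed.

Section Contraction.
Variables (K : hilbertType R) (X : bop K).
Hypothesis X1 : opnorm X <= 1.

Let contr h : rnorm (X h) <= rnorm h.
Proof.
by apply: le_trans (rnorm_le_opnorm X h) _; rewrite ler_piMl ?rnorm_ge0.
Qed.

Let contrX N h : rnorm ((X ^+ N) h) <= rnorm h.
Proof.
elim: N => [|N IHN]; first by rewrite expr0.
by rewrite exprS; apply: le_trans (contr _) IHN.
Qed.

(** The difference of the squares of the two sides is
    [(1 - q^2) (||h||^2 - ||X h||^2)]: this is the von Neumann inequality for a
    Moebius map, with the denominator cleared. *)
Lemma moebius_contractive h :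
  rnorm (q%:C%C *: h - X h) <= rnorm (h - q%:C%C *: X h).
Proof.
rewrite -(@ler_pXn2r _ 2)// ?nnegrE ?rnorm_ge0//.
have := rnormB_sqr q 1 h (X h); rewrite scale1r => ->.
have := rnormB_sqr 1 q h (X h); rewrite scale1r => ->.
have : rnorm (X h) ^+ 2 <= rnorm h ^+ 2 by rewrite ler_pXn2r ?nnegrE ?rnorm_ge0.
have : 0 <= 1 - q ^+ 2 by rewrite subr_ge0 expr_le1//; case/andP: q01 => *; lra.
by move=> ? ?; nra.
Qed.

Let opnorm_num_geo N : opnorm (horner_alg X (num * geo N)) <= 1 + q ^+ N.
Proof.
have q0 : 0 <= q by case/andP: q01.
apply: opnorm_le => [|h]; first by rewrite addr_ge0 ?exprn_ge0.
rewrite hornerM horner_num (le_trans (moebius_contractive _))//.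
rewrite -horner_den -hornerM den_geo raddfB/= rmorph1 linearZ/= hornerXn.
rewrite (le_trans (rnormB _ _))// mulrDl mul1r lerD2l.
by rewrite rnormZr ger0_norm ?exprn_ge0// ler_wpM2l ?exprn_ge0.
Qed.

Let opnorm_num_X N : opnorm (horner_alg X (num * 'X^N)) <= 2.
Proof.
have /andP[q0 q1] := q01.
apply: opnorm_le => // h.
rewrite hornerM horner_num (le_trans (moebius_contractive _))//.
rewrite hornerXn (le_trans (rnormB _ _))// rnormZr ger0_norm//.
have hN := contrX N h; have := contr ((X ^+ N) h).
have := rnorm_ge0 (X ((X ^+ N) h)).
by nra.
Qed.

Variables (H : hilbertType R) (T : bop H) (c : R).
Hypothesis c0 : 0 <= c.
Hypothesis functional_calculus :
  forall p : {poly R[i]}, opnorm (horner_alg T p) <= c * opnorm (horner_alg X p).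

(** This is the bound [c] on the norm of the Moebius map at [T], with the
    denominator cleared.  The functional calculus is applied to [num * geo N],
    whose norm at [X] is at most [1 + q^N]; the error term [q^N num X^N] is
    controlled by the functional calculus as well. *)
Lemma rnorm_moebius_le x :
  rnorm (q%:C%C *: x - T x) <= c * rnorm (x - q%:C%C *: T x).
Proof.
have /andP[q0 q1] := q01.
rewrite -horner_num -horner_den; set w := horner_alg T den x.
apply: (@le_of_le_addX _ _ _ (c * (rnorm w + 2 * rnorm x)) q) => // N.
have -> : horner_alg T num x = horner_alg T (num * geo N) w +
    (q ^+ N)%:C%C *: horner_alg T (num * 'X^N) x.
  rewrite /w -hornerM -mulrA [geo N * _]mulrC den_geo mulrBr mulr1 -scalerAr.
  move: (num * 'X^N) (num) => p r.
  by rewrite [horner_alg T (r - _)]raddfB/= linearZ/=; apply/esym; exact: subrK.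
apply: le_trans (rnormD _ _) _; rewrite rnormZr ger0_norm ?exprn_ge0//.
have b1 : rnorm (horner_alg T (num * geo N) w) <= c * (1 + q ^+ N) * rnorm w.
  apply: le_trans (rnorm_le_opnorm _ _) _; rewrite ler_wpM2r ?rnorm_ge0//.
  by apply: le_trans (functional_calculus _) _; exact: ler_wpM2l.
have b2 : rnorm (horner_alg T (num * 'X^N) x) <= c * 2 * rnorm x.
  apply: le_trans (rnorm_le_opnorm _ _) _; rewrite ler_wpM2r ?rnorm_ge0//.
  by apply: le_trans (functional_calculus _) _; exact: ler_wpM2l.
have := ler_wpM2l (exprn_ge0 N q0) b2.
by lra.
Qed.

End Contraction.
End Moebius.

(** The test function is the Moebius map with parameter [1 / c], because the
    terms in [||T x||^2] cancel exactly for this parameter.  For [c = 1]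
    the map degenerates to a constant, and the bound is Cauchy-Schwarz. *)
Lemma rdot_spectral_le (R : realType) (K H : hilbertType R) (X : bop K)
    (T : bop H) (c : R) : opnorm X <= 1 -> 1 <= c ->
  (forall p : {poly R[i]},
    opnorm (horner_alg T p) <= c * opnorm (horner_alg X p)) ->
  forall x, rnorm x = 1 -> rdot (T x) x <= 2^-1 * (c + c^-1).
Proof.
move=> X1 c1 XT x x1; have c0 : 0 < c by lra.
have [c1'|c1'] := leP c 1.
  have -> : c = 1 by lra.
  have := rnormB_sqr 1 1 x (T x); rewrite rdotC x1.
  have Tx : rnorm (T x) <= 1.
    have := XT 'X; rewrite !horner_algX => TX.
    have := rnorm_le_opnorm T x; rewrite x1; nra.
  have := sqr_ge0 (rnorm (1%:C%C *: x - 1%:C%C *: T x)).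
  have := rnorm_ge0 (T x).
  by move=> ? ? ?; rewrite invr1; nra.
have q01 : 0 <= c^-1 < 1 by rewrite invr_ge0 ltW//= invf_lt1.
have := rnorm_moebius_le q01 X1 (ltW c0) XT x.
rewrite -(@ler_pXn2r _ 2)// ?nnegrE ?mulr_ge0 ?rnorm_ge0 ?(ltW c0)// exprMn.
have := rnormB_sqr c^-1 1 x (T x); rewrite scale1r => ->.
have := rnormB_sqr 1 c^-1 x (T x); rewrite scale1r => ->.
rewrite x1 rdotC; set r := rdot (T x) x; set t := rnorm (T x).
have cq : c * c^-1 = 1 by rewrite divff// gt_eqF.
set q := c^-1 in cq q01 *; move=> h.
have h' : 2 * (c - q) * r <= c ^+ 2 - q ^+ 2.
  have e1 : c ^+ 2 * (1 ^+ 2 * 1 ^+ 2 - 2 * 1 * q * r + q ^+ 2 * t ^+ 2) =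
    c ^+ 2 - 2 * c * (c * q) * r + (c * q) ^+ 2 * t ^+ 2 by ring.
  move: h; rewrite e1 cq; lra.
have : (c - q) * (2 * r) <= (c - q) * (c + q) by lra.
rewrite ler_pM2l; lra.
Qed.

(** * Operator matrices *)

Section OperatorMatrices.
Variables (R : realType) (H : hilbertType R) (n : nat).
Implicit Types S T : 'M[bop H]_n.+1.

Lemma opmxE T x i : opmx T x i = \sum_j T i j (x j).
Proof. by rewrite ffunE. Qed.

Lemma bop_sumE (I : finType) (F : I -> bop H) x :
  (\sum_i F i) x = \sum_i F i x.
Proof. by elim/big_rec2: _ => // i y1 y2 _ <-. Qed.

Fact opmx_is_zmod_morphism : zmod_morphism (@opmx R H n).
Proof.
move=> S T; apply: bopP => x; apply/ffunP => i.
transitivity (opmx S x i - opmx T x i); last by rewrite !ffunE.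
by rewrite !opmxE -sumrB; apply: eq_bigr => j _; rewrite !mxE.
Qed.

HB.instance Definition _ := GRing.isZmodMorphism.Build
  'M[bop H]_n.+1 (bop (dirsum H n)) (@opmx R H n) opmx_is_zmod_morphism.

Lemma opmx_scalar (k : R[i]) : opmx (k%:A)%:M = k *: (1 : bop (dirsum H n)).
Proof.
apply: bopP => x; apply/ffunP => i.
rewrite opmxE (bigD1 i)//= big1 => [|j ji].
  by rewrite addr0 mxE eqxx mulr1n !ffunE.
by rewrite mxE eq_sym (negbTE ji).
Qed.

Fact opmx_is_monoid_morphism : monoid_morphism (@opmx R H n).
Proof.
split=> [|S T].
  by rewrite -[RHS]scale1r -opmx_scalar scale1r.
apply: bopP => x; apply/ffunP => i; rewrite !opmxE.
transitivity (\sum_j \sum_k S i k (T k j (x j))).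
  by apply: eq_bigr => j _; rewrite mxE bop_sumE.
rewrite exchange_big; apply: eq_bigr => k _.
by rewrite opmxE linear_sum.
Qed.

HB.instance Definition _ := GRing.isMonoidMorphism.Build
  'M[bop H]_n.+1 (bop (dirsum H n)) (@opmx R H n) opmx_is_monoid_morphism.

End OperatorMatrices.

Section Representations.
Variables (R : realType) (A : algType R[i]).

(** Square matrices over [A] carry no scaling by [R[i]], so a complex scalar
    enters as a scalar matrix. *)
Definition mx_in_alg n : R[i] -> 'M[A]_n.+1 := scalar_mx \o in_alg A.

Section OneRepresentation.
Variables (H : hilbertType R) (f : {lrmorphism A -> bop H}) (n : nat).

Definition mxrep : 'M[A]_n.+1 -> bop (dirsum H n) := fun a => opmx (map_mx f a).

Lemma mxrep_in_alg k : mxrep (mx_in_alg n k) = k%:A.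
Proof.
by rewrite /mxrep /mx_in_alg /= map_scalar_mx /= linearZ /= rmorph1 opmx_scalar.
Qed.

HB.instance Definition _ := GRing.RMorphism.copy mxrep
  (@opmx R H n \o (map_mx f : 'M[A]_n.+1 -> 'M[bop H]_n.+1)).
HB.instance Definition _ := GRing.RMorphism.copy (@mx_in_alg n)
  ((scalar_mx : A -> 'M[A]_n.+1) \o in_alg A).

Lemma mxrepZ k a : mxrep (mx_in_alg n k * a) = k *: mxrep a.
Proof. by rewrite rmorphM /= mxrep_in_alg -scalerAl mul1r. Qed.

(** A polynomial in the operator of [a] is the operator of an element of
    M_n(A), and this element does not depend on the representation: this is what
    transfers polynomial bounds from one representation to another. *)
Lemma horner_mxrep (p : {poly R[i]}) a :
  horner_alg (mxrep a) p = mxrep (map_poly (@mx_in_alg n) p).[a].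
Proof.
rewrite -horner_map -map_poly_comp /horner_alg /horner_morph.
by congr horner; apply: eq_map_poly => k; rewrite /= mxrep_in_alg.
Qed.

End OneRepresentation.
End Representations.

(** * Two-by-two block matrices *)

Section Blocks.
Variables (R : realType) (H : hilbertType R) (n : nat).
Implicit Types u v : dirsum H n.

(** The size index of [dirsum] is off by one: [dirsum H (n + n.+1)] has
    [n.+1 + n.+1] summands. *)
Definition dirsum_pair u v : dirsum H (n + n.+1) :=
  [ffun i : 'I_(n.+1 + n.+1) =>
    match fintype.split i with inl j => u j | inr j => v j end].

Lemma dirsum_pairEl u v (j : 'I_n.+1) : dirsum_pair u v (lshift n.+1 j) = u j.
Proof.
by rewrite ffunE; case: split_ordP => k => [/lshift_inj->|/eqP]//; rewrite eq_lrshift.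
Qed.

Lemma dirsum_pairEr u v (j : 'I_n.+1) : dirsum_pair u v (rshift n.+1 j) = v j.
Proof.
by rewrite ffunE; case: split_ordP => k => [/eqP|/rshift_inj->]//; rewrite eq_rlshift.
Qed.

Lemma dirsum_pairP (x : dirsum H (n + n.+1)) : exists u v, x = dirsum_pair u v.
Proof.
exists [ffun j : 'I_n.+1 => x (lshift n.+1 j)], [ffun j : 'I_n.+1 => x (rshift n.+1 j)].
apply/ffunP => i; have [j ->|j ->] := @split_ordP n.+1 n.+1 i.
  by rewrite dirsum_pairEl ffunE.
by rewrite dirsum_pairEr ffunE.
Qed.

Lemma rdot_pair u v u' v' :
  rdot (dirsum_pair u v) (dirsum_pair u' v') = rdot u u' + rdot v v'.
Proof.
rewrite /rdot -raddfD; congr complex.Re.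
rewrite -[LHS]/(\sum_(i < n.+1 + n.+1) _) big_split_ord/=.
by congr (_ + _); apply: eq_bigr => j _; rewrite ?dirsum_pairEl ?dirsum_pairEr.
Qed.

Lemma rnorm_pair u v :
  rnorm (dirsum_pair u v) ^+ 2 = rnorm u ^+ 2 + rnorm v ^+ 2.
Proof. by rewrite !rnorm_sqr rdot_pair. Qed.

Lemma opmx_block (a b c d : 'M[bop H]_n.+1) u v :
  @opmx R H (n + n.+1) (block_mx a b c d) (dirsum_pair u v) =
  dirsum_pair (opmx a u + opmx b v) (opmx c u + opmx d v).
Proof.
apply/ffunP => i; rewrite opmxE -[LHS]/(\sum_(i < n.+1 + n.+1) _) big_split_ord/=.
have [j ->|j ->] := @split_ordP n.+1 n.+1 i.
  rewrite dirsum_pairEl [RHS]ffunE !opmxE.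
  congr (_ + _); apply: eq_bigr => k _.
    by rewrite dirsum_pairEl (block_mxEul a b c d).
  by rewrite dirsum_pairEr (block_mxEur a b c d).
rewrite dirsum_pairEr [RHS]ffunE !opmxE.
congr (_ + _); apply: eq_bigr => k _.
  by rewrite dirsum_pairEl (block_mxEdl a b c d).
by rewrite dirsum_pairEr (block_mxEdr a b c d).
Qed.

End Blocks.

Section MoebiusBlock.
Variables (R : realType) (A : algType R[i]) (n : nat) (t : R).
Hypothesis t01 : 0 <= t <= 1.

(** The value of [(z + t) / (1 + t z)] at the nilpotent block matrix whose only
    nonzero block is [a], in the upper right corner. *)
Definition moebius_block (a : 'M[A]_n.+1) : 'M[A]_((n + n.+1).+1) :=
  block_mx (mx_in_alg A n t%:C%C) (mx_in_alg A n (1 - t ^+ 2)%:C%C * a)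
    0 (mx_in_alg A n t%:C%C).

Variables (H : hilbertType R) (f : {lrmorphism A -> bop H}).

Lemma mxrep_moebius_block a u v :
  mxrep f (moebius_block a) (dirsum_pair u v) =
  dirsum_pair (t%:C%C *: u + (1 - t ^+ 2)%:C%C *: mxrep f a v) (t%:C%C *: v).
Proof.
have fblock : map_mx f (moebius_block a) = block_mx
    (map_mx f (mx_in_alg A n t%:C%C))
    (map_mx f (mx_in_alg A n (1 - t ^+ 2)%:C%C * a))
    (map_mx f (0 : 'M[A]_n.+1)) (map_mx f (mx_in_alg A n t%:C%C)).
  by rewrite /moebius_block; apply: (@map_block_mx _ _ f n.+1 n.+1 n.+1 n.+1).
rewrite {1}/mxrep fblock opmx_block -!/(mxrep f _).
by rewrite mxrep_in_alg mxrepZ rmorph0 add0r.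
Qed.

(** With [s = 1 - t^2], the square of the norm of the image of [(u, v)] is at
    most [(t ||u|| + s ||v||)^2 + t^2 ||v||^2], which is
    [||u||^2 + ||v||^2 - s (||u|| - t ||v||)^2]. *)
Lemma opnorm_moebius_block a :
  opnorm (mxrep f a) <= 1 -> opnorm (mxrep f (moebius_block a)) <= 1.
Proof.
have /andP[t0 t1] := t01; have s0 : 0 <= 1 - t ^+ 2 by nra.
move=> a1; apply: opnorm_le => // x; have [u [v ->]] := dirsum_pairP x.
rewrite mxrep_moebius_block mul1r -(@ler_pXn2r _ 2)// ?nnegrE ?rnorm_ge0//.
rewrite !rnorm_pair rnormZr ger0_norm//.
have av : rnorm (mxrep f a v) <= rnorm v.
  by apply: le_trans (rnorm_le_opnorm _ _) _; rewrite ler_piMl ?rnorm_ge0.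
have uv : rnorm (t%:C%C *: u + (1 - t ^+ 2)%:C%C *: mxrep f a v) <=
    t * rnorm u + (1 - t ^+ 2) * rnorm v.
  rewrite (le_trans (rnormD _ _))// !rnormZr !ger0_norm// lerD2l.
  by rewrite ler_wpM2l.
have := rnorm_ge0 u; have := rnorm_ge0 v; move: uv.
have := rnorm_ge0 (t%:C%C *: u + (1 - t ^+ 2)%:C%C *: mxrep f a v).
move: (rnorm (_ + _)) (rnorm u) (rnorm v) => z x1 x2 z0 zle x20 x10.
have : z ^+ 2 <= (t * x1 + (1 - t ^+ 2) * x2) ^+ 2.
  by rewrite ler_pXn2r ?nnegrE// addr_ge0 ?mulr_ge0.
have : 0 <= (1 - t ^+ 2) * (x1 - t * x2) ^+ 2 by rewrite mulr_ge0 ?sqr_ge0.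
by lra.
Qed.

(** The quadratic form is tested on pairs [(u, v)] in which [u] is the multiple
    of [mxrep f a v] with the same norm as [v]. *)
Lemma opnorm_le_numradius_moebius_block a :
  t + 2^-1 * (1 - t ^+ 2) * opnorm (mxrep f a) <=
  numradius (mxrep f (moebius_block a)).
Proof.
have /andP[t0 t1] := t01; have s0 : 0 <= 1 - t ^+ 2 by nra.
set w := numradius _.
have wP u v : t * rnorm u ^+ 2 + (1 - t ^+ 2) * rdot (mxrep f a v) u +
    t * rnorm v ^+ 2 <= w * (rnorm u ^+ 2 + rnorm v ^+ 2).
  have := rdot_le_numradius (mxrep f (moebius_block a)) (dirsum_pair u v).
  rewrite mxrep_moebius_block rnorm_pair rdot_pair rdotDl !rdotZl -!rnorm_sqr.
  by rewrite -/w.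
have tw : t <= w.
  have [h h0] := @hilbert_nontrivial R (dirsum H n).
  have [v v1 _] := rnorm_normalize h0.
  by have := wP 0 v; rewrite rdotC /rdot linear0l rnorm0 v1 /=; lra.
have [st|st] := eqVneq (1 - t ^+ 2) 0; first by rewrite st mulr0 mul0r addr0.
have s_gt0 : 0 < 1 - t ^+ 2 by rewrite lt_neqAle eq_sym st.
suff : opnorm (mxrep f a) <= 2 * (w - t) / (1 - t ^+ 2).
  by rewrite ler_pdivlMr//; lra.
apply: opnorm_le => [|v]; first by rewrite divr_ge0// mulr_ge0// subr_ge0.
rewrite mulrAC ler_pdivlMr//.
have [v0|v0] := eqVneq (rnorm v) 0.
  by rewrite (rnorm_eq0 v0) linear0 !rnorm0 mul0r mulr0.
have [y0|y0] := eqVneq (mxrep f a v) 0.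
  by rewrite y0 rnorm0 mul0r !mulr_ge0 ?rnorm_ge0// subr_ge0.
have [e e1 ye] := rnorm_normalize y0.
(* e is the direction of mxrep f a v. *)
have := wP ((rnorm v)%:C%C *: e) v.
have v_gt0 : 0 < rnorm v by rewrite lt_neqAle eq_sym v0 rnorm_ge0.
rewrite rdotC rdotZl {1}ye rdotC rdotZl -rnorm_sqr rnormZr e1 mulr1.
rewrite (ger0_norm (rnorm_ge0 v)) => h.
rewrite -(ler_pM2l v_gt0); move: h.
by lra.
Qed.

End MoebiusBlock.

(** * The complete norms *)

Lemma ereal_sup_supP (R : realType) (I : Type) (T : I -> Type)
    (D : forall i, set (T i)) (F : forall i, T i -> R) (M : \bar R) :
  (ereal_sup [set ereal_sup [set (F i a)%:E | a in D i] | i in [set: I]] <= M)%E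
  <-> forall i a, D i a -> ((F i a)%:E <= M)%E.
Proof.
split=> [/ereal_supP sM i a Da|FM].
  have /ereal_supP := sM _ (imageT (fun i => ereal_sup _) i).
  by apply; exists a.
apply/ereal_supP => _ [i _ <-]; apply/ereal_supP => _ [a Da <-].
exact: FM.
Qed.

Section CompleteNorms.
Variables (R : realType) (A : operatorAlgType R) (H K : hilbertType R).
Variables (Phi : {lrmorphism A -> bop H}) (iota : {lrmorphism A -> bop K}).
Hypothesis mxnormE :
  forall n (a : 'M[A]_n.+1), mxnorm n a = opnorm (mxrep iota a).

Lemma opnorm_mxrep_le_cbnorm (c : R) : cbnorm Phi = c%:E ->
  forall n (a : 'M[A]_n.+1), opnorm (mxrep Phi a) <= c * opnorm (mxrep iota a).
Proof.
move=> cE n a.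
have /ereal_sup_supP cP : (cbnorm Phi <= c%:E)%E by rewrite cE.
have [a0|a0] := eqVneq (opnorm (mxrep iota a)) 0.
  have -> : a = 0 by apply: mxnorm0_eq0; rewrite mxnormE.
  rewrite !rmorph0; suff op0 (L : hilbertType R) : opnorm (0 : bop L) = 0.
    by rewrite !op0 mulr0.
  apply/le_anti; rewrite opnorm_ge0 andbT.
  by have := opnormZ_le 0 (0 : bop L); rewrite scaler0 rnorm0 mul0r.
have a_gt0 : 0 < opnorm (mxrep iota a).
  by rewrite lt_neqAle eq_sym a0 opnorm_ge0.
set s := opnorm (mxrep iota a) in a0 a_gt0 *.
have rs : rnorm (s^-1%:C%C : R[i]) = s^-1.
  by rewrite /rnorm ger0_norm// ler0c invr_ge0 ltW.
have rs' : rnorm (s%:C%C : R[i]) = s by rewrite /rnorm ger0_norm// ler0c ltW.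
have := cP n (mx_in_alg A n s^-1%:C%C * a); rewrite /= mxnormE mxrepZ.
have b1 : opnorm (s^-1%:C%C *: mxrep iota a) <= 1.
  by apply: le_trans (opnormZ_le _ _) _; rewrite rs mulVf.
move=> /(_ b1); rewrite lee_fin -[ampliation _ _]/(mxrep Phi _) mxrepZ => h.
have -> : mxrep Phi a = s%:C%C *: (s^-1%:C%C *: mxrep Phi a).
  by rewrite scalerA -rmorphM/= divff// scale1r.
apply: le_trans (opnormZ_le _ _) _; rewrite rs' mulrC.
by rewrite ler_wpM2r// ltW.
Qed.

Lemma cbnorm_ge1 : (1%:E <= cbnorm Phi)%E.
Proof.
have /ereal_sup_supP/(_ 0 1) := lexx (cbnorm Phi).
by rewrite /= mxnormE -[ampliation _ _]/(mxrep Phi _) !rmorph1 !opnorm1; apply.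
Qed.

Lemma wcbnorm_le (c : R) : 1 <= c -> cbnorm Phi = c%:E ->
  (wcbnorm Phi <= (2^-1 * (c + c^-1))%:E)%E.
Proof.
move=> c1 cE; have cP := opnorm_mxrep_le_cbnorm cE.
apply/ereal_sup_supP => n a /=; rewrite mxnormE => a1; rewrite lee_fin.
apply: numradius_le_rdot => u x u1 x1; rewrite -[ampliation _ _]/(mxrep Phi a) -mxrepZ.
apply: (@rdot_spectral_le _ _ _ (mxrep iota (mx_in_alg A n u * a))) => //.
  by rewrite mxrepZ; apply: le_trans (opnormZ_le _ _) _; rewrite u1 mul1r.
by move=> p; rewrite !horner_mxrep.
Qed.

Lemma wcbnorm_ge (c : R) : 1 <= c -> cbnorm Phi = c%:E ->
  ((2^-1 * (c + c^-1))%:E <= wcbnorm Phi)%E.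
Proof.
move=> c1 cE.
have wcbP := (ereal_sup_supP _ _ _).1 (lexx (wcbnorm Phi)).
case: (wcbnorm Phi) wcbP => [w|_|]; last 2 first.
- exact: leey.
- move=> /(_ 0 1); rewrite /= mxnormE rmorph1 opnorm1 => /(_ (lexx _)).
  by rewrite leeNy_eq.
move=> wP; rewrite lee_fin.
have c_gt0 : 0 < c by lra.
have t01 : 0 <= c^-1 <= 1 by rewrite invr_ge0 ltW//= invf_le1.
have cK : c * c^-1 = 1 by rewrite divff// gt_eqF.
set t := c^-1 in t01 cK *.
have bound n (a : 'M[A]_n.+1) : opnorm (mxrep iota a) <= 1 ->
    t + 2^-1 * (1 - t ^+ 2) * opnorm (mxrep Phi a) <= w.
  move=> a1; apply: le_trans (opnorm_le_numradius_moebius_block t01 Phi a) _.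
  rewrite -lee_fin; apply: wP; rewrite /= mxnormE.
  exact: opnorm_moebius_block.
(* The unit of A alone settles the case c = 1, where 1 - t^2 vanishes. *)
have tw : t + 2^-1 * (1 - t ^+ 2) <= w.
  by have := bound 0 1; rewrite !rmorph1 !opnorm1 mulr1; apply.
have [c_le1|c_gt1] := leP c 1.
  have c1E : c = 1 by lra.
  have t1E : t = 1 by rewrite /t c1E invr1.
  by move: tw; rewrite c1E t1E; lra.
have s_gt0 : 0 < 1 - t ^+ 2.
  have t_lt1 : t < 1 by rewrite /t invf_lt1.
  by case/andP: t01 => *; nra.
have : c <= 2 * (w - t) / (1 - t ^+ 2).
  rewrite -lee_fin -cE; apply/ereal_sup_supP => n a /=; rewrite mxnormE => a1.
  by rewrite lee_fin ler_pdivlMr//; have := bound n a a1; lra.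
rewrite ler_pdivlMr//.
have -> : c * (1 - t ^+ 2) = c - (c * t) * t by ring.
by rewrite cK; lra.
Qed.

End CompleteNorms.

Theorem theorem2p3 (R : realType) (A : operatorAlgType R) (H : hilbertType R)
    (Phi : {lrmorphism A -> bop H}) :
  completely_bounded Phi ->
  wcbnorm Phi =
    (2^-1 * (fine (cbnorm Phi) + (fine (cbnorm Phi))^-1))%:E.
Proof.
rewrite /completely_bounded => cb.
have [K [iota mxnormE]] := @mxnorm_representation R A.
have c1 := cbnorm_ge1 Phi mxnormE.
have cE : cbnorm Phi = (fine (cbnorm Phi))%:E.
  by rewrite fineK// ge0_fin_numE//; apply: le_trans c1; rewrite lee_fin.
rewrite cE lee_fin in c1.
apply/le_anti/andP; split; first exact: (@wcbnorm_le _ _ _ _ Phi iota).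
exact: (@wcbnorm_ge _ _ _ _ Phi iota).
Qed.
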